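(* For any Tychonoff space $X$, if $X$ is Menger at infinity, then $X$ is Baire.
   Context: A space $Y$ is Menger if for every sequence $(\mathcal{U}_n)_{n\in\omega}$ of open covers of $Y$ there are finite subfamilies $\mathcal{V}_n\subseteq\mathcal{U}_n$ such that $\bigcup_{n\in\omega}\mathcal{V}_n$ covers $Y$. A Tychonoff space $X$ is Menger at infinity if for some (equivalently, for every) Hausdorff compactification $bX$ of $X$ the remainder $bX\setminus X$ is Menger. A topological space is Baire if the intersection of every countable family of open dense subsets is dense. *)

(* Defs.v *)
From HB Require Import structures.
From mathcomp Require Import all_boot all_order all_algebra.
From mathcomp Require Import all_classical all_reals all_analysis.

Set Implicit Arguments.
Unset Strict Implicit.
Unset Printing Implicit Defensive.

Local Open Scope classical_set_scope.

(* [completely_regular_space] is stated with uniformities; [uniform_separatorP]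
   gives the form with continuous functions into [0, 1]. *)
Definition tychonoff_space (X : topologicalType) : Prop :=
  completely_regular_space X /\ hausdorff_space X.

Definition is_open_cover (Y : topologicalType) (U : set (set Y)) : Prop :=
  (forall A, U A -> open A) /\ \bigcup_(A in U) A = [set: Y].

Definition menger_space (Y : topologicalType) : Prop :=
  forall U : nat -> set (set Y), (forall n, is_open_cover (U n)) ->
  exists V : nat -> set (set Y),
    (forall n, finite_set (V n) /\ V n `<=` U n) /\
    \bigcup_n (\bigcup_(A in V n) A) = [set: Y].

(* A homeomorphism onto its image: the last clause says that [e] is open as a
   map onto [range e]. *)
Definition topological_embedding (X K : topologicalType) (e : X -> K) : Prop :=
  [/\ injective e, continuous e &
      forall U : set X, open U ->
        exists2 W : set K, open W & e @` U = W `&` range e].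

Definition hausdorff_compactification
    (X K : topologicalType) (e : X -> K) : Prop :=
  [/\ compact [set: K], hausdorff_space K,
      topological_embedding e & dense (range e)].

Definition remainder (X K : topologicalType) (e : X -> K) : topologicalType :=
  set_type (~` range e).

Definition menger_at_infinity (X : topologicalType) : Prop :=
  exists (K : topologicalType) (e : X -> K),
    hausdorff_compactification e /\ menger_space (remainder e).

Definition baire_space (X : topologicalType) : Prop :=
  forall F : set (set X), countable F ->
    (forall A, F A -> open A /\ dense A) -> dense (\bigcap_(A in F) A).

(* Main.v *)
(* Let [K] compactify [X], let the [W n] be open dense in [K] and [G] nonempty
   open; we look for a common point of [G] and all the [W n] in [X].
   Shrink open sets inside [G], along a tree with countable branching, so that
   the closure of a node at level [n + 1] lies in its parent and in [W n].
   Letting the children of a node shrink to a point of [X], every point of the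
   remainder has a neighbourhood meeting only finitely many nodes of each level.
   Menger's property applied to these neighbourhoods then excludes finitely many
   nodes per level, and a branch avoiding all of them has an intersection
   disjoint from the remainder. By compactness the intersection is nonempty, so
   it contains a point of [X] in [G] and in every [W n]. *)
Require Import Defs.
From mathcomp Require Import all_boot all_order all_algebra.
From mathcomp Require Import all_classical all_reals all_analysis.

Set Implicit Arguments.
Unset Strict Implicit.
Unset Printing Implicit Defensive.

Local Open Scope classical_set_scope.

(** The Menger property of a subspace is phrased with open sets of [K] because the tree lives in
    [K]. Lists stand for finite subfamilies so that induction applies to them. *)
Definition menger_subset (K : topologicalType) (R : set K) : Prop :=
  forall U : nat -> set (set K), (forall n B, U n B -> open B) ->
  (forall n y, R y -> exists2 B, U n B & B y) ->
  exists V : nat -> seq (set K),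
    (forall n B, B \in V n -> U n B) /\
    forall y, R y -> exists n, exists2 B, B \in V n & B y.

Lemma menger_space_subset (K : topologicalType) (R : set K) :
  menger_space (set_type R) -> menger_subset R.
Proof.
move=> mR U Uo Uc.
pose t (B : set K) : set (set_type R) := set_val @^-1` B.
have [|V' [V'fin V'cov]] := mR (fun n => t @` U n).
  move=> n; split=> [_ [B UB <-]|].
    by apply: open_comp (Uo _ _ UB) => y _; exact: initial_continuous.
  apply/seteqP; split=> // y _.
  have [|B UB By] := Uc n (set_val y); first exact: set_valP.
  by exists (t B) => //; exists B.
have /choice[V VP] : forall n, exists s : seq (set K),
    (forall B, B \in s -> U n B) /\ forall A, V' n A -> exists2 B, B \in s & A = t B.
  move=> n; have [/finite_seqP[s' s'E] sub] := V'fin n.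
  (* Several members of [U n] may have the same trace, so one lift is chosen for each trace in
     [V' n]; [setT] is a dummy value. *)
  have /choice[g gP] : forall A, exists B, V' n A -> U n B /\ t B = A.
    move=> A; have [VA|nVA] := pselect (V' n A); last by exists setT.
    by have [B UB <-] := sub _ VA; exists B.
  exists (map g s'); split=> [_ /mapP[A As ->]|A VA].
    by have [] := gP A; rewrite // s'E.
  exists (g A); last by case: (gP _ VA).
  by apply: map_f; move: VA; rewrite s'E.
exists V; split=> [n|y Ry]; first by case: (VP n).
have : (\bigcup_n (\bigcup_(A in V' n) A)) (SigSub (mem_set Ry)) by rewrite V'cov.
move=> [n _ [A VA Ay]]; exists n.
have [B Bs AE] := (VP n).2 _ VA.
by exists B => //; rewrite AE in Ay.
Qed.

Lemma nbhs_setC_all (K : topologicalType) (x : K) (s : seq (set K)) :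
  (forall B, B \in s -> nbhs x (~` B)) ->
  nbhs x [set z | forall B, B \in s -> ~ B z].
Proof.
elim: s => [_|A s IH sN]; first by apply: filterS filterT.
have As : nbhs x (~` A) by apply: sN; rewrite inE eqxx.
have ss : forall B, B \in s -> nbhs x (~` B).
  by move=> B Bs; apply: sN; rewrite inE Bs orbT.
apply: filterS (filterI As (IH ss)) => z [nA nB] B.
by rewrite inE => /orP[/eqP->|/nB].
Qed.

Lemma nbhs_forall_leq (K : topologicalType) (x : K) (M : nat -> set K) (k : nat) :
  (forall j, nbhs x (M j)) -> nbhs x [set z | forall j, j <= k -> M j z].
Proof.
move=> MN; elim: k => [|k IH].
  by apply: filterS (MN 0) => z Mz j; rewrite leqn0 => /eqP->.
apply: filterS (filterI (MN k.+1) IH) => z [Mk Ml] j.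
by rewrite leq_eqVlt => /orP[/eqP->|/Ml].
Qed.

(* The sets [C k] shrink towards a point of the dense set [D], which the Menger
   property of [~` D] allows us to separate from [~` D] by a sequence. *)
Lemma locally_finite_children (K : topologicalType) (D W V : set K) :
  compact [set: K] -> hausdorff_space K -> dense D -> menger_subset (~` D) ->
  open W -> dense W -> open V -> V !=set0 ->
  exists C : nat -> set K,
    (forall k, [/\ open (C k), C k !=set0 & closure (C k) `<=` V `&` W]) /\
    forall y, ~ D y -> exists O : set K, [/\ open O, O y &
      exists j, forall k, j <= k -> O `&` C k = set0].
Proof.
move=> cK hK dD mR oW dW oV V0.
have oVW : open (V `&` W) by apply: openI.
have [x [[Vx Wx] Dx]] : (V `&` W) `&` D !=set0 by apply: dD => //; exact: dW.
have xVW : nbhs x (V `&` W) by apply: open_nbhs_nbhs.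
(* The same family serves at every stage; it covers the complement of [D] because [x] lies in [D]
   and [K] is Hausdorff. *)
have [||S [SU Scov]] := mR (fun _ => [set B | open B /\ nbhs x (~` B)]).
- by move=> n B [].
- move=> _ y nDy; have xy : x != y by apply/eqP => xy; rewrite xy in Dx.
  move: hK; rewrite open_hausdorff => /(_ x y xy)[[A B] /= [xA yB] [oA oB AB]].
  exists B; last by rewrite inE in yB.
  split=> //; rewrite inE in xA.
  apply: filterS (open_nbhs_nbhs (conj oA xA)) => z Az Bz.
  by move/eqP: AB => AB; have : (A `&` B) z by []; rewrite AB.
pose M j := [set z | forall B, B \in S j -> ~ B z].
have MN j : nbhs x (M j) by apply: nbhs_setC_all => B /SU[].
(* Only the finitely many stages up to [k] are avoided, so the target remains a neighbourhood of [x]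
   and regularity fits a closure inside it. A point covered at stage [j] is then separated from
   every [N k] with [j <= k]. *)
have /choice[N NP] : forall k, exists N : set K, nbhs x N /\
    closure N `<=` (V `&` W) `&` [set z | forall j, j <= k -> M j z].
  move=> k.
  have T : nbhs x ((V `&` W) `&` [set z | forall j, j <= k -> M j z]).
    by apply: filterI => //; exact: nbhs_forall_leq.
  have [N xN Nsub] := compact_regular hK cK (filterT : nbhs x setT) T.
  by exists N.
exists (fun k => interior (N k)); split=> [k|y nDy].
  have [xN Nsub] := NP k; split; first exact: open_interior.
    by exists x; exact: nbhs_singleton (nbhs_interior xN).
  move=> z /(closureS (@interior_subset _ (N k))) /Nsub[] //.
have [j [B BS By]] := Scov _ nDy.
exists B; split=> //; first by case: (SU _ _ BS).
exists j => k jk; rewrite -subset0 => z [Bz /interior_subset/subset_closure].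
by move=> /(NP k).2[_ /(_ _ jk _ BS)]; apply.
Qed.

Lemma exists_cons_notin (F : seq (seq nat)) (s : seq nat) :
  exists k, k :: s \notin F.
Proof.
(* The sum bounds the head of every list in [F]. *)
pose m := \sum_(t <- F) head 0 t; exists m.+1.
apply/negP => sF; have : m.+1 <= m by rewrite [leqRHS](big_rem _ sF) /= leq_addr.
by rewrite ltnn.
Qed.

Section MengerTree.
Variables (K : topologicalType) (R G : set K).
Variable child : nat -> set K -> nat -> set K.

(* A node is reached by reading the list of choices from right to left. *)
Fixpoint node (s : seq nat) : set K :=
  if s is k :: s' then child (size s') (node s') k else G.

(** Induction on the level. A node whose parent is missed by a neighbourhood is missed too, since it
    lies in its parent. For each of the finitely many other parents, a further intersection leaves
    only finitely many children. *)
Lemma node_locally_finite :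
  (forall k s, node (k :: s) `<=` node s) ->
  (forall s y, R y -> exists O : set K, [/\ open O, O y &
      exists j, forall k, j <= k -> O `&` node (k :: s) = set0]) ->
  forall n y, R y -> exists O : set K, [/\ open O, O y &
    exists F : seq (seq nat), forall s, size s = n -> s \notin F ->
      O `&` node s = set0].
Proof.
move=> sub lf; elim=> [|n IH] y Ry.
  exists setT; split=> //; first exact: openT.
  by exists [:: [::]] => -[].
have [N [oN Ny [F avoidF]]] := IH y Ry.
have [P [oP Py [F' PF']]] : exists P : set K, [/\ open P, P y &
    exists F' : seq (seq nat), forall k s, s \in F -> k :: s \notin F' ->
      P `&` node (k :: s) = set0].
  elim: F {avoidF} => [|t F [P [oP Py [F' PF']]]].
    by exists setT; split=> //; [exact: openT | exists [::]].
  have [Q [oQ Qy [j Qj]]] := lf t y Ry.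
  exists (P `&` Q); split=> //; first exact: openI.
  (* Only the first [j] children of [t] can meet [Q]. *)
  exists (map (cons^~ t) (iota 0 j) ++ F') => k s.
  rewrite mem_cat inE negb_or => /orP[/eqP->|sF] /andP[kj kF']; last first.
    by rewrite setIAC PF' // set0I.
  have jk : j <= k.
    by rewrite leqNgt; apply: contra kj => kj; apply: map_f; rewrite mem_iota.
  by rewrite -setIA Qj // setI0.
exists (N `&` P); split=> //; first exact: openI.
exists F' => -[//|k s] [sn] ksF'.
have [sF|sF] := boolP (s \in F); first by rewrite -setIA PF' // setI0.
by rewrite -subset0 => z [[Nz _] /sub sz]; rewrite -(avoidF s sn sF).
Qed.

Lemma menger_branch :
  menger_subset R ->
  (forall n y, R y -> exists N : set K, [/\ open N, N y &
    exists F : seq (seq nat), forall s, size s = n -> s \notin F ->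
      N `&` node s = set0]) ->
  exists b : nat -> seq nat,
    [/\ b 0 = [::], forall n, exists k, b n.+1 = k :: b n &
      forall y, R y -> exists n, ~ node (b n) y].
Proof.
move=> mR lf.
(* The shift is needed because every branch passes through the root: stage [n] of the Menger
   property controls level [n.+1]. *)
pose avoids n (N : set K) (F : seq (seq nat)) :=
  forall s, size s = n.+1 -> s \notin F -> N `&` node s = set0.
have [||S [SU Scov]] := mR (fun n => [set N | open N /\ exists F, avoids n N F]).
- by move=> n B [].
- by move=> n y Ry; have [N [oN Ny avoidF]] := lf n.+1 y Ry; exists N.
have /choice[F FP] : forall n, exists F, forall N, N \in S n -> avoids n N F.
  move=> n; move: (SU n); elim: (S n) => [|N s IH] sU; first by exists [::].
  have [F1 F1P] : exists F, avoids n N F by case: (sU N); rewrite // inE eqxx.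
  have [|F2 F2P] := IH; first by move=> B Bs; apply: sU; rewrite inE Bs orbT.
  exists (F1 ++ F2) => B; rewrite inE => /orP[/eqP->|Bs] t tn;
    rewrite mem_cat negb_or => /andP[t1 t2]; [exact: F1P | exact: F2P].
have /choice[next nextP] : forall ns : nat * seq nat, exists k,
    k :: ns.2 \notin F ns.1.
  by move=> ns; exact: exists_cons_notin.
pose b := fix b n := if n is m.+1 then next (m, b m) :: b m else [::].
have sb n : size (b n) = n by elim: n => //= n ->.
exists b; split=> // [n|y Ry]; first by exists (next (n, b n)).
have [n [N NS Ny]] := Scov y Ry.
exists n.+1 => ny.
have : (N `&` node (b n.+1)) y by [].
by rewrite (FP n N NS) //; exact: nextP (n, b n).
Qed.

End MengerTree.

Lemma nested_closure_nonempty (K : topologicalType) (B : nat -> set K) :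
  compact [set: K] -> (forall n, B n !=set0) ->
  (forall n, closure (B n.+1) `<=` B n) -> \bigcap_n B n !=set0.
Proof.
move=> cK B0 Bsub.
have /choice[x xB] : forall n, exists x, B n x by exact: B0.
(* A cluster point of the [x n] lies in each [closure (B n.+1)], which contains a tail of the
   sequence. *)
have [|y [_ xy]] := cK (x @ \oo) _; first exact: filterT.
have Bdec n m : n <= m -> B m `<=` B n.
  move=> /subnK<-; elim: (m - n) => // d IH z.
  by rewrite addSn => Bz; apply/IH/Bsub/subset_closure.
exists y => n _; apply: Bsub => A yA; apply: xy => //.
by apply: filterS (nbhs_infty_ge n.+1) => m nm; exact: Bdec (xB m).
Qed.

Lemma menger_compl_meet (K : topologicalType) (D G : set K) (W : nat -> set K) :
  compact [set: K] -> hausdorff_space K -> dense D -> menger_subset (~` D) ->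
  (forall n, open (W n) /\ dense (W n)) -> open G -> G !=set0 ->
  (G `&` \bigcap_n W n) `&` D !=set0.
Proof.
move=> cK hK dD mR Wod oG G0.
have /choice[child' childP] : forall nV : nat * set K, exists C : nat -> set K,
    open nV.2 -> nV.2 !=set0 ->
    (forall k, [/\ open (C k), C k !=set0 & closure (C k) `<=` nV.2 `&` W nV.1]) /\
    forall y, ~ D y -> exists O : set K, [/\ open O, O y &
      exists j, forall k, j <= k -> O `&` C k = set0].
  move=> [n V] /=; have [oW dW] := Wod n.
  have [[oV V0]|nV] := pselect (open V /\ V !=set0).
    by have [C CP] := locally_finite_children cK hK dD mR oW dW oV V0; exists C.
  (* A dummy value, never reached from the root: all nodes are open and nonempty by [ndok]. *)
  by exists (fun=> set0) => oV V0; case: nV.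
pose nd := node G (fun n V => child' (n, V)).
have ndok s : open (nd s) /\ nd s !=set0.
  elim: s => [//|k s [os s0]].
  by have [/(_ k)[]] := childP (size s, nd s) os s0.
have ndsub k s : closure (nd (k :: s)) `<=` nd s `&` W (size s).
  have [os s0] := ndok s.
  by have [/(_ k)[]] := childP (size s, nd s) os s0.
have [|b [b0 bS bR]] := @menger_branch _ (~` D) G (fun n V => child' (n, V)) mR.
  apply: node_locally_finite => [k s z /subset_closure/ndsub[]//|s y nDy].
  have [os s0] := ndok s.
  by have [_ /(_ _ nDy)] := childP (size s, nd s) os s0.
have sb n : size (b n) = n.
  by elim: n => [|n IH]; [rewrite b0 | have [k ->] := bS n; rewrite /= IH].
have bsub n : closure (nd (b n.+1)) `<=` nd (b n) `&` W n.
  by have [k ->] := bS n; have := @ndsub k (b n); rewrite sb.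
have [||y yb] := @nested_closure_nonempty _ (fun n => nd (b n)) cK.
- by move=> n; case: (ndok (b n)).
- by move=> n z /bsub[].
have yW n : W n y by have [] := bsub n y (subset_closure (yb n.+1 I)).
exists y; split; first by split=> //; have := yb 0 I; rewrite b0.
apply: contrapT => /bR[n]; apply; exact: yb.
Qed.

Lemma dense_embedding_extension (X K : topologicalType) (e : X -> K)
    (A : set X) (W : set K) :
  continuous e -> dense (range e) -> dense A -> e @` A = W `&` range e -> dense W.
Proof.
move=> ce de dA AW O O0 oO.
have [y [Oy [z _ zE]]] := de O O0 oO; rewrite -zE in Oy.
have [||x [Ox Ax]] := dA (e @^-1` O).
- by exists z.
- by apply: open_comp => // ? _; exact: ce.
have [Wx _] : (W `&` range e) (e x) by rewrite -AW; exists x.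
by exists (e x).
Qed.

Theorem corollary3p7 (X : topologicalType) :
  tychonoff_space X -> menger_at_infinity X -> baire_space X.
Proof.
move=> _ [K [e [[cK hK [ie ce oe] de] mR]]] F cF FP.
(* An empty family has the whole space as intersection; otherwise [f] enumerates [F] as a
   sequence. *)
have [F0|[f]] := pfcard_geP cF.
  by move=> O O0 _; rewrite F0 bigcap_set0 setIT.
have fF n : F (f n) by exact: funS.
have extend (A : set X) : open A -> exists W, open W /\ e @` A = W `&` range e.
  by move=> /oe[W oW AW]; exists W.
have /choice[W WP] n := extend _ (FP _ (fF n)).1.
move=> O [z Oz] oO.
have [G [oG GO]] := extend O oO.
have memE (A : set X) (B : set K) x : e @` A = B `&` range e -> B (e x) -> A x.
  move=> AB Bx; have : (e @` A) (e x) by rewrite AB; split=> //; exists x.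
  by move=> [x' Ax' /ie <-].
have [| |y [[Gy Wy] [x _ xy]]] :=
    menger_compl_meet cK hK de (menger_space_subset mR) _ oG (W := W).
- move=> n; have [oW WE] := WP n; split=> //.
  exact: dense_embedding_extension ce de (FP _ (fF n)).2 WE.
- by exists (e z); have [] : (G `&` range e) (e z) by rewrite -GO; exists z.
subst; exists x; split; first exact: memE GO Gy.
move=> A FA; have [n _ fn] := @surj _ _ _ _ f _ FA.
by rewrite -fn; apply: memE (WP n).2 (Wy n I).
Qed.
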